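(* Let $n\ge1$ and $P=\{x\in\{0,1\}^n\mid\sum_{i=1}^n x_i=1\}$. Let $L\cap\mathbb{S}^{n+1}_+$ be an SDP relaxation of $P$ that satisfies the normalization and arrow constraints and that contains the lifted equality $\langle uu^T,Y\rangle=0$ (that is, $\langle uu^T,Y\rangle=0$ for every $Y\in L$), where $u=-e_0+\sum_{i=1}^n e_i\in\mathbb{R}^{n+1}$. Then $$uu^T\in L^\perp\cap\mathbb{S}^{n+1}_+,\qquad\text{but}\qquad L^\perp\cap\mathbb{FW}_k^{n+1}=\{0\}\quad\text{for every positive integer } k\le n.$$
   Context: $\mathbb{S}^{p}$ is the space of real symmetric $p\times p$ matrices with inner product $\langle X,Y\rangle=\operatorname{tr}(XY)$, and $\mathbb{S}^p_+$ is the positive semidefinite cone. Coordinates of $\mathbb{R}^{n+1}$ and $\mathbb{S}^{n+1}$ are indexed by $\{0,1,\dots,n\}$, with standard unit vectors $e_0,\dots,e_n$. For an affine subspace $L$, $L^\perp=\{Z\mid\langle Z,Y\rangle=0\ \forall Y\in L\}$. For an affine subspace $L\subseteq\mathbb{S}^{n+1}$, the set $L\cap\mathbb{S}^{n+1}_+$ is an SDP relaxation of $P$ if $\binom{1}{x}\binom{1}{x}^T\in L$ for every $x\in P$. It satisfies the normalization and arrow constraints if every $Y\in L$ satisfies $Y_{00}=1$ and $Y_{ii}=Y_{0i}$ for $i=1,\dots,n$. The factor-width-$k$ cone $\mathbb{FW}_k^{N}$ is the set of finite sums $\sum_t g_tg_t^T$ with $g_t\in\mathbb{R}^N$ having at most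 $k$ nonzero entries. *)

(* Defs.v *)
From HB Require Import structures.
From mathcomp Require Import all_boot all_order all_algebra.
From mathcomp Require Import all_classical reals.

Set Implicit Arguments.
Unset Strict Implicit.
Unset Printing Implicit Defensive.

Import Order.TTheory GRing.Theory Num.Theory.

Local Open Scope classical_set_scope.
Local Open Scope ring_scope.

(* R^N is ['cV[R]_N].  S^N is a subset of ['M[R]_N], so every set of symmetric
   matrices carries its symmetry condition explicitly. *)
Definition sym_mx (R : realType) (N : nat) : set 'M[R]_N :=
  [set Y | Y \is symmetricmx].
Arguments sym_mx : clear implicits.

Definition inner_mx (R : realType) (N : nat) (X Y : 'M[R]_N) : R :=
  \tr (X *m Y).

Definition psd_mx (R : realType) (N : nat) : set 'M[R]_N :=
  [set Y | sym_mx R N Y /\ forall v : 'cV[R]_N, 0 <= (v^T *m Y *m v) 0 0].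
Arguments psd_mx : clear implicits.

(* A translate of a linear subspace; in particular nonempty. *)
Definition affine_subspace (R : realType) (N : nat) (L : set 'M[R]_N) : Prop :=
  L `<=` sym_mx R N /\
  exists (A : 'M[R]_N) (V : {vspace 'M[R]_N}),
    L = [set A + X | X in [set X | X \in V]].

Definition orth (R : realType) (N : nat) (L : set 'M[R]_N) : set 'M[R]_N :=
  [set Z | sym_mx R N Z /\ forall Y, L Y -> inner_mx Z Y = 0].

(* The indices 0, 1, ..., n of R^(n+1) are [ord0] and [lift ord0 i] for
   [i : 'I_n]. *)
Definition homog (R : realType) (n : nat) (x : 'cV[R]_n) : 'cV[R]_n.+1 :=
  col_mx (const_mx 1 : 'cV[R]_1) x.

Definition unit_vec (R : realType) (N : nat) (i : 'I_N) : 'cV[R]_N :=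
  delta_mx i 0.

Definition sdp_relaxation (R : realType) (n : nat)
    (P : set 'cV[R]_n) (L : set 'M[R]_n.+1) : Prop :=
  forall x, P x -> L (homog x *m (homog x)^T).

Definition normalization_arrow (R : realType) (n : nat)
    (L : set 'M[R]_n.+1) : Prop :=
  forall Y, L Y ->
    Y ord0 ord0 = 1 /\
    forall i : 'I_n, Y (lift ord0 i) (lift ord0 i) = Y ord0 (lift ord0 i).

Definition FW (R : realType) (k N : nat) : set 'M[R]_N :=
  [set Z | exists (m : nat) (g : 'I_m -> 'cV[R]_N),
     (forall t, (#|[pred i | g t i 0%R != 0%R]| <= k)%N) /\
     Z = \sum_(t < m) g t *m (g t)^T].
Arguments FW : clear implicits.

Definition one_hot (R : realType) (n : nat) : set 'cV[R]_n :=
  [set x | (forall i, x i 0 = 0 \/ x i 0 = 1) /\ \sum_(i < n) x i 0 = 1].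
Arguments one_hot : clear implicits.

Definition u_vec (R : realType) (n : nat) : 'cV[R]_n.+1 :=
  - unit_vec R ord0 + \sum_(i < n) unit_vec R (lift ord0 i).
Arguments u_vec : clear implicits.

(* Main.v *)
Require Import Defs.
From HB Require Import structures.
From mathcomp Require Import all_boot all_order all_algebra.
From mathcomp Require Import all_classical reals.

(* Pairing [Z = \sum_t g_t g_t^T] with the lifted vertex [hh^T], [h = (1, e_i)],
   gives [\sum_t (g_t0 + g_ti)^2].  If [Z] is orthogonal to [L], all these
   squares vanish, so each [g_t] is a multiple of [u], which has n + 1 nonzero
   entries; a factor with at most n nonzero entries is therefore 0. *)

Set Implicit Arguments.
Unset Strict Implicit.
Unset Printing Implicit Defensive.

Import Order.TTheory GRing.Theory Num.Theory.

Local Open Scope classical_set_scope.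
Local Open Scope ring_scope.

Lemma symmetric_rank1 (R : realType) (N : nat) (g : 'cV[R]_N) :
  sym_mx R N (g *m g^T).
(* [symmetricmx] is the Hermitian predicate with sign exponent 0 and identity conjugation; both have
   to be stripped before transposing. *)
Proof. by apply/eqP; rewrite expr0 scale1r map_mx_id // trmx_mul trmxK. Qed.

Lemma quad_form_rank1 (R : realType) (N : nat) (g v : 'cV[R]_N) :
  (v^T *m (g *m g^T) *m v) 0 0 = ((g^T *m v) 0 0) ^+ 2.
Proof.
(* Regroup as [(v^T *m g) *m (g^T *m v)], a product of two equal scalars. *)
rewrite mulmxA -mulmxA [LHS]mxE big_ord1 expr2; congr (_ * _).
by rewrite -[g^T *m v]trmxK trmx_mul trmxK [RHS]mxE.
Qed.

Lemma inner_mx_rank1 (R : realType) (N : nat) (Z : 'M[R]_N) (v : 'cV[R]_N) :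
  inner_mx Z (v *m v^T) = (v^T *m Z *m v) 0 0.
Proof. by rewrite /inner_mx mulmxA mxtrace_mulC mulmxA trace_mx11. Qed.

Lemma psd_rank1 (R : realType) (N : nat) (g : 'cV[R]_N) :
  psd_mx R N (g *m g^T).
Proof.
split; first exact: symmetric_rank1.
by move=> v; rewrite quad_form_rank1 sqr_ge0.
Qed.

Lemma homog0 (R : realType) (n : nat) (x : 'cV[R]_n) : homog x ord0 0 = 1.
Proof.
rewrite /homog (_ : ord0 = lshift n (ord0 : 'I_1)); last exact: val_inj.
by rewrite (@col_mxEu _ 1) mxE.
Qed.

Lemma homog_lift (R : realType) (n : nat) (x : 'cV[R]_n) (i : 'I_n) :
  homog x (lift ord0 i) 0 = x i 0.
Proof.
rewrite /homog (_ : lift ord0 i = rshift 1 i); last exact: val_inj.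
by rewrite (@col_mxEd _ 1).
Qed.

Lemma mul_homog_unit (R : realType) (n : nat) (g : 'cV[R]_n.+1) (i : 'I_n) :
  (g^T *m homog (unit_vec R i)) 0 0 = g ord0 0 + g (lift ord0 i) 0.
Proof.
rewrite mxE big_ord_recl homog0 mxE mulr1; congr (_ + _).
rewrite (bigD1 i) //= homog_lift !mxE !eqxx mulr1 big1 ?addr0 // => j ji.
by rewrite homog_lift !mxE (negPf ji) mulr0.
Qed.

Lemma one_hot_unit (R : realType) (n : nat) (i : 'I_n) :
  one_hot R n (unit_vec R i).
Proof.
split=> [j|]; first by rewrite mxE; case: (_ && _); [right | left].
rewrite (bigD1 i) //= mxE !eqxx big1 ?addr0 // => j ji.
by rewrite mxE (negPf ji).
Qed.

(** Otherwise the support would be all of ['I_N], with [N > k] elements. *)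
Lemma sparse_has_zero (R : realType) (N k : nat) (g : 'cV[R]_N) :
  (#|[pred i | g i 0%R != 0%R]| <= k)%N -> (k < N)%N -> exists i, g i 0 = 0.
Proof.
move=> gk kN; have [/existsP[i /eqP gi0]|/existsPn gN0] :=
  boolP [exists i, g i 0 == 0]; first by exists i.
move: (leq_ltn_trans gk kN).
by rewrite (eq_card (B := 'I_N)) ?card_ord ?ltnn // => i; rewrite !inE gN0.
Qed.

(** Some entry of [g] is zero. Whether it sits at [ord0] or at another index, the relations force
    [g ord0 0 = 0], and then every other entry vanishes too. *)
Lemma sparse_opp_eq0 (R : realType) (n k : nat) (g : 'cV[R]_n.+1) :
  (#|[pred i | g i 0%R != 0%R]| <= k)%N -> (k <= n)%N ->
  (forall i, g ord0 0 + g (lift ord0 i) 0 = 0) -> g = 0.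
Proof.
(* The dimension is [n.+1], so [k <= n] is exactly the strict bound needed for a zero entry. *)
move=> gk kn g_opp; have [j gj0] := sparse_has_zero gk kn.
have g00 : g ord0 0 = 0.
  case: (unliftP ord0 j) gj0 => [i|] -> //.
  by move=> gi0; have := g_opp i; rewrite gi0 addr0.
apply/matrixP => l c; rewrite ord1 [RHS]mxE.
by case: (unliftP ord0 l) => [i|] -> //; have := g_opp i; rewrite g00 add0r.
Qed.

(** The pairing with [h *m h^T] is a sum of real squares, so it can be zero only termwise. *)
Lemma orth_sum_rank1 (R : realType) (N m : nat) (L : set 'M[R]_N)
    (g : 'I_m -> 'cV[R]_N) (h : 'cV[R]_N) :
  orth L (\sum_(t < m) g t *m (g t)^T) -> L (h *m h^T) ->
  forall t, ((g t)^T *m h) 0 0 = 0.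
Proof.
move=> [_ ZL] /ZL; rewrite inner_mx_rank1 mulmx_sumr mulmx_suml summxE.
under eq_bigr do rewrite quad_form_rank1.
move=> /psumr_eq0P sq0 t; apply/eqP; rewrite -sqrf_eq0.
by rewrite sq0 // => s _; apply: sqr_ge0.
Qed.

Theorem mainTheorem6 (R : realType) (n : nat) (hn : (1 <= n)%N)
    (L : set 'M[R]_n.+1)
    (hL : affine_subspace L)
    (hrel : sdp_relaxation (one_hot R n) L)
    (harrow : normalization_arrow L)
    (hlift : forall Y, L Y -> inner_mx (u_vec R n *m (u_vec R n)^T) Y = 0) :
  (orth L `&` psd_mx R n.+1) (u_vec R n *m (u_vec R n)^T) /\
  (forall k : nat, (0 < k)%N -> (k <= n)%N ->
     orth L `&` FW R k n.+1 = [set 0]).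
Proof.
split.
  split; last exact: psd_rank1.
  by split; [exact: symmetric_rank1 | exact: hlift].
move=> k _ kn; apply/seteqP; split=> [Z [ZL [m [g [gk ZE]]]]|_ ->]; last first.
  split.
    split=> [|Y _]; last by rewrite /inner_mx mul0mx mxtrace0.
    by apply/eqP; rewrite expr0 scale1r map_mx_id // trmx0.
  (* Zero is the empty sum of factors. *)
  exists 0%N, (fun=> 0); split=> [[]//|].
  by rewrite big_ord0.
rewrite ZE in ZL *; apply: big1 => t _; suff -> : g t = 0 by rewrite mul0mx.
(* Each relation comes from the lifted vertex at [unit_vec R i], which lies in [L] by [hrel]. *)
apply: sparse_opp_eq0 (gk t) kn _ => i; rewrite -mul_homog_unit.
exact: orth_sum_rank1 ZL (hrel _ (one_hot_unit R i)) t.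
Qed.
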